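(* Let $\tilde A_i=(a_i;\,l_i^{\mu L},r_i^{\mu L},l_i^{\mu U},r_i^{\mu U};\,l_i^{\nu L},r_i^{\nu L},l_i^{\nu U},r_i^{\nu U})_{LR}$, $i=1,2$, be $LR$-type IVIFNs with the same shape functions, where $a_1+r_1^{\nu L}<0$, and $\tilde A_2$ is arbitrary. Then $\tilde A_1\odot\tilde A_2=(a;\,l^{\mu L},r^{\mu L},l^{\mu U},r^{\mu U};\,l^{\nu L},r^{\nu L},l^{\nu U},r^{\nu U})_{LR}$, where $a=a_1a_2$ and, for each $\kappa\in\{\mu L,\mu U,\nu L,\nu U\}$, $$l^\kappa=a_1a_2-\min\{(a_1+r_1^\kappa)(a_2+r_2^\kappa),(a_1-l_1^\kappa)(a_2+r_2^\kappa)\},\quad r^\kappa=\max\{(a_1-l_1^\kappa)(a_2-l_2^\kappa),(a_1+r_1^\kappa)(a_2-l_2^\kappa)\}-a_1a_2.$$ Moreover the conditions for an $LR$-type representation hold: all eight spreads of the product are positive and $l^{\mu U}\ge l^{\mu L}$, $l^{\nu L}\ge l^{\nu U}$, $l^{\nu L}\ge l^{\mu L}$, $l^{\nu U}\ge l^{\mu U}$, and likewise with $r$ in place of $l$.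
   Context: A shape function is a continuous, strictly decreasing, invertible $f:[0,\infty)\to[0,1]$ with $f(0)=1$ and $\lim_{x\to\infty}f(x)=0$. Fix shape functions $L,R,L',R'$. An $LR$-type interval-valued intuitionistic fuzzy number (IVIFN) is written $\tilde A=(a;l^{\mu L},r^{\mu L},l^{\mu U},r^{\mu U};l^{\nu L},r^{\nu L},l^{\nu U},r^{\nu U})_{LR}$, where $a\in\mathbb R$ is its mean value and the eight spreads are positive reals with $l^{\mu U}\ge l^{\mu L}$, $r^{\mu U}\ge r^{\mu L}$, $l^{\nu L}\ge l^{\nu U}$, $r^{\nu L}\ge r^{\nu U}$, $l^{\nu L}\ge l^{\mu L}$, $r^{\nu L}\ge r^{\mu L}$, $l^{\nu U}\ge l^{\mu U}$, $r^{\nu U}\ge r^{\mu U}$. It encodes a lower membership function equal to $L((a-x)/l^{\mu L})$ on $[a-l^{\mu L},a]$, $R((x-a)/r^{\mu L})$ on $[a,a+r^{\mu L}]$, and $0$ otherwise; an upper membership function of the same form with $L',R',l^{\mu U},r^{\mu U}$; a lower non-membership function equal to $1-L((a-x)/l^{\nu L})$ on $[a-l^{\nu L},a]$, $1-R((x-a)/r^{\nu L})$ on $[a,a+r^{\nu L}]$, and $1$ otherwise; and an upper non-membership function of the same form with $L',R',l^{\nu U},r^{\nu U}$. At each $x$ the supremum of the membership interval plus the supremum of the non-membership interval is at most $1$. The product $\tilde A_1\odot\tilde A_2$ is formed cutwise by interval multiplication and read off at the level where the inverse shape functions equal $0$ (giving the mean) and at the level where they equal $1$ (giving the spreads). That is,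 it is the tuple (with the same shape functions) with mean $a=a_1a_2$ and spreads determined, for each $\kappa\in\{\mu L,\mu U,\nu L,\nu U\}$, by $$[a-l^{\kappa},a+r^{\kappa}]=[a_1-l_1^{\kappa},a_1+r_1^{\kappa}]\times[a_2-l_2^{\kappa},a_2+r_2^{\kappa}],$$ where $I\times J=\{xy:x\in I,y\in J\}$. *)

(* Defs.v *)
(* MathComp-Analysis *)
From HB Require Import structures.
From mathcomp Require Import all_boot all_order all_algebra.
From mathcomp Require Import all_classical all_reals all_analysis.

Set Implicit Arguments.
Unset Strict Implicit.
Unset Printing Implicit Defensive.

Import Order.TTheory GRing.Theory Num.Theory.
Import numFieldNormedType.Exports.

Local Open Scope classical_set_scope.
Local Open Scope ring_scope.

(* A function on [0, +oo) is a function on R of which only the values on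
   [0, +oo) matter.  Being strictly decreasing with limit 0, it never takes the
   value 0, so invertibility can only mean bijectivity onto ]0, 1]. *)
Record shapeFunction (R : realType) := ShapeFunction {
  shape_fun :> R -> R;
  shape_range : forall x, 0 <= x -> 0 <= shape_fun x <= 1;
  shape_continuous : {within `[0, +oo[, continuous shape_fun};
  shape_decreasing : forall x y, 0 <= x -> x < y -> shape_fun y < shape_fun x;
  shape_invertible : set_bij `[0, +oo[ `]0, 1] shape_fun;
  shape_at0 : shape_fun 0 = 1;
  shape_cvg0 : shape_fun x @[x --> +oo] --> (0 : R) }.

(* Lower and upper membership (mu), lower and upper non-membership (nu). *)
Inductive grade := muL | muU | nuL | nuU.

(* The shape functions L, S, L', S' (S for the right-hand ones, R being the
   reals) are parameters of the type, so two tuples of the same type have the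
   same shape functions. *)
Record lrTuple (R : realType) (L S L' S' : shapeFunction R) := LRTuple {
  mean : R;
  lspread : grade -> R;
  rspread : grade -> R }.

Definition lr_interval (R : realType) (L S L' S' : shapeFunction R)
    (A : lrTuple L S L' S') (k : grade) : set R :=
  `[mean A - lspread A k, mean A + rspread A k].

Definition lr_profile (R : realType) (f g : R -> R) (a l r x : R) : R :=
  if a - l <= x <= a then f ((a - x) / l)
  else if a <= x <= a + r then g ((x - a) / r)
  else 0.

Section Encoding.
Context (R : realType) (L S L' S' : shapeFunction R).
Context (A : lrTuple L S L' S').

Definition lower_membership (x : R) : R :=
  lr_profile L S (mean A) (lspread A muL) (rspread A muL) x.

Definition upper_membership (x : R) : R :=
  lr_profile L' S' (mean A) (lspread A muU) (rspread A muU) x.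

(* lr_profile vanishes off the interval, so these are 1 there. *)
Definition lower_nonmembership (x : R) : R :=
  1 - lr_profile L S (mean A) (lspread A nuL) (rspread A nuL) x.

Definition upper_nonmembership (x : R) : R :=
  1 - lr_profile L' S' (mean A) (lspread A nuU) (rspread A nuU) x.

Definition spreads_pos : Prop :=
  forall k, 0 < lspread A k /\ 0 < rspread A k.

Definition spreads_ordered (s : grade -> R) : Prop :=
  [/\ s muL <= s muU, s nuU <= s nuL, s muL <= s nuL & s muU <= s nuU].

Definition lr_conditions : Prop :=
  [/\ spreads_pos, spreads_ordered (lspread A) & spreads_ordered (rspread A)].

(* The upper functions are the suprema of the membership and non-membership
   intervals. *)
Definition is_ivifn : Prop :=
  lr_conditions /\
  forall x, upper_membership x + upper_nonmembership x <= 1.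

End Encoding.

(* The product as a relation: the mean and the four interval equations
   determine A when it exists, but for arbitrary tuples it need not exist. *)
Definition is_lr_product (R : realType) (L S L' S' : shapeFunction R)
    (A1 A2 A : lrTuple L S L' S') : Prop :=
  mean A = mean A1 * mean A2 /\
  forall k, lr_interval A k =
    [set x * y | x in lr_interval A1 k & y in lr_interval A2 k].

(* Main.v *)
(* Since A1 is negative, x * y decreases in y and each product interval runs from
   the smaller of the corner products with the right end of A2 to the larger of
   those with the left end.  The levels are nested, muL in muU in nuU in nuL, so
   the hypothesis at nuL makes every level of A1 negative, and nesting passes to
   the products. *)
Require Import Defs.
From HB Require Import structures.
From mathcomp Require Import all_boot all_order all_algebra.
From mathcomp Require Import all_classical all_reals all_analysis.
From mathcomp Require Import lra.

Import Order.TTheory GRing.Theory Num.Theory.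
Import numFieldNormedType.Exports.

Local Open Scope classical_set_scope.
Local Open Scope ring_scope.

Section IntervalProduct.
Context (R : realFieldType).
Implicit Types a b c d p q : R.

(* If z lies above p c then z <= q c with c > 0, so y = c works; if z lies below
   p d then z >= q d with d < 0, so y = d works; otherwise x = p works. *)
Lemma itv_cc_mul_neg p q c d : p <= q -> q < 0 -> c <= d ->
  [set x * y | x in `[p, q] & y in `[c, d]] =
  `[Num.min (q * d) (p * d), Num.max (p * c) (q * c)]%classic.
Proof.
move=> pq q0 cd; have p0 : p < 0 by lra.
apply/seteqP; split => [_ [x xpq [y ycd <-]]|z]; rewrite /= !in_itv /=.
  move: xpq ycd; rewrite /= !in_itv /= => /andP[px xq] /andP[cy yd].
  rewrite ge_min le_max; apply/andP; split; apply/orP.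
  (* Since [x < 0], [x * y >= x * d]; the sign of [d] decides whether [x * d] is least at [p] or at
     [q]. The upper bound is the same with [c]. *)
  - by have [d0|d0] := leP 0 d; [right|left]; nra.
  - by have [c0|c0] := leP 0 c; [right|left]; nra.
rewrite ge_min le_max => /andP[zmin zmax].
have [zpc|zpc] := leP z (p * c); last first.
  have zqc : z <= q * c by case/orP: zmax => // ?; lra.
  have c0 : 0 < c by nra.
  exists (z / c); last by exists c; rewrite /= ?in_itv /= ?lexx // divfK ?gt_eqF.
  by rewrite /= in_itv /= ler_pdivlMr // ler_pdivrMr // zqc ltW.
have [zpd|zpd] := leP (p * d) z; last first.
  have zqd : q * d <= z by case/orP: zmin => // ?; lra.
  have d0 : d < 0 by nra.
  exists (z / d); last first.
    by exists d; rewrite /= ?in_itv /= ?lexx ?andbT // divfK ?lt_eqF.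
  by rewrite /= in_itv /= ler_ndivlMr // ler_ndivrMr // zqd ltW.
exists p; first by rewrite /= in_itv /= lexx.
exists (z / p); last by rewrite mulrC divfK ?lt_eqF.
by rewrite /= in_itv /= ler_ndivlMr // ler_ndivrMr // ![_ * p]mulrC zpc.
Qed.

(** Serves uniqueness of the product, where the candidate's spreads have unknown signs, so only one
    interval is known to be nonempty. Membership of [p] in the other one yields [c <= d], and then
    each end can be tested for membership. *)
Lemma itv_cc_inj p q c d : p <= q ->
  `[p, q]%classic = `[c, d]%classic -> p = c /\ q = d.
Proof.
move=> pq E.
have mem x : (p <= x <= q) = (c <= x <= d).
  have := congr1 (fun A : set R => A x) E.
  by rewrite /= !in_itv /= => H; apply/idP/idP; rewrite H.
have /andP[cp pd] : c <= p <= d by rewrite -mem lexx.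
have /andP[cq qd] : c <= q <= d by rewrite -mem lexx andbT.
have /andP[pc _] : p <= c <= q by rewrite mem lexx (le_trans cp).
have /andP[_ dq] : p <= d <= q by rewrite mem lexx andbT (le_trans cp).
by split; apply/eqP; rewrite eq_le ?pc ?cp ?qd.
Qed.

(** Makes the left spreads positive: [a * d < a * b], and by the sign of [d] one of the two corners
    is at most [a * d]. *)
Lemma min_mul_neg_lt p a q b d : p <= a -> a <= q -> a < 0 -> b < d ->
  Num.min (q * d) (p * d) < a * b.
Proof.
move=> pa aq a0 bd; rewrite gt_min; apply/orP.
by have [d0|d0] := leP 0 d; [right|left]; nra.
Qed.

Lemma max_mul_neg_gt p a q b c : p <= a -> a <= q -> a < 0 -> c < b ->
  a * b < Num.max (p * c) (q * c).
Proof.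
move=> pa aq a0 cb; rewrite lt_max; apply/orP.
by have [c0|c0] := leP 0 c; [right|left]; nra.
Qed.

(** Both inner corners [x * d] are at least [x * d'], as [x < 0]. The sign of [d'] then selects one
    outer corner that lies below both. *)
Lemma min_mul_neg_le p p' q q' d d' :
  p' <= p -> p <= q -> q <= q' -> q' < 0 -> d <= d' ->
  Num.min (q' * d') (p' * d') <= Num.min (q * d) (p * d).
Proof.
move=> pp pq qq q0 dd; rewrite le_min !ge_min.
by apply/andP; split; apply/orP; have [d0|d0] := leP 0 d';
  [right|left|right|left]; nra.
Qed.

Lemma max_mul_neg_le p p' q q' c c' :
  p' <= p -> p <= q -> q <= q' -> q' < 0 -> c' <= c ->
  Num.max (p * c) (q * c) <= Num.max (p' * c') (q' * c').
Proof.
move=> pp pq qq q0 cc; rewrite ge_max !le_max.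
by apply/andP; split; apply/orP; have [c0|c0] := leP 0 c';
  [right|left|right|left]; nra.
Qed.

End IntervalProduct.

Theorem proposition3p1p11 (R : realType) (L S L' S' : shapeFunction R)
    (A1 A2 : lrTuple L S L' S')
    (hA1 : is_ivifn A1) (hA2 : is_ivifn A2)
    (hneg : mean A1 + rspread A1 nuL < 0) :
  let a1 := mean A1 in let l1 := lspread A1 in let r1 := rspread A1 in
  let a2 := mean A2 in let l2 := lspread A2 in let r2 := rspread A2 in
  let P : lrTuple L S L' S' :=
    LRTuple L S L' S' (a1 * a2)
      (fun k => a1 * a2 - Num.min ((a1 + r1 k) * (a2 + r2 k))
                                  ((a1 - l1 k) * (a2 + r2 k)))
      (fun k => Num.max ((a1 - l1 k) * (a2 - l2 k))
                        ((a1 + r1 k) * (a2 - l2 k)) - a1 * a2) in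
  (forall A : lrTuple L S L' S', is_lr_product A1 A2 A <-> A = P) /\
  lr_conditions P.
Proof.
case: hA1 => -[pos1 [lLU1 lUL1 lL1 lU1] [rLU1 rUL1 rL1 rU1]] _.
case: hA2 => -[pos2 [lLU2 lUL2 lL2 lU2] [rLU2 rUL2 rL2 rU2]] _.
move=> a1 l1 r1 a2 l2 r2 P.
have q0 k : a1 + r1 k < 0 by rewrite /a1 /r1; case: k; lra.
have pos k : [/\ 0 < l1 k, 0 < r1 k, 0 < l2 k & 0 < r2 k].
  by have [? ?] := pos1 k; have [? ?] := pos2 k.
have posP : spreads_pos P.
  move=> k; have := q0 k; have [? ? ? ?] := pos k => ?.
  by rewrite /= !subr_gt0; split;
    [apply: min_mul_neg_lt|apply: max_mul_neg_gt]; lra.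
have prodE k : lr_interval P k =
    [set x * y | x in lr_interval A1 k & y in lr_interval A2 k].
  have := q0 k; have [? ? ? ?] := pos k => ?.
  rewrite /lr_interval -/a1 -/l1 -/r1 -/a2 -/l2 -/r2 itv_cc_mul_neg; [|lra..].
  by rewrite /= subKr subrKC.
split=> [A|].
  split=> [[meanA itvA]|->]; last by split.
  case: A meanA itvA => a l r /= -> itvA.
  (* Both tuples have the same product set as interval, nonempty because the spreads of [P] are
     positive; equal ends and equal means leave equal spreads. *)
  have spreadE k : lspread P k = l k /\ rspread P k = r k.
    have [l0 r0] := posP k.
    have [] := itv_cc_inj _ (mean P - lspread P k) (mean P + rspread P k)
      (a1 * a2 - l k) (a1 * a2 + r k).
    - by lra.
    - by rewrite -[LHS]/(lr_interval P k) prodE -itvA.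
    by move=> /addrI /oppr_inj -> /addrI ->.
  by congr LRTuple; apply/funext => k; have [] := spreadE k.
(* A negative first factor reverses the second, so left spreads compare through [r2] and right ones
   through [l2]. Negativity is taken at the outer level [k']. *)
have lP k k' : l1 k <= l1 k' -> r1 k <= r1 k' -> r2 k <= r2 k' ->
    lspread P k <= lspread P k'.
  have [? ? ? ?] := pos k; have := q0 k' => *.
  by rewrite lerD2l lerN2; apply: min_mul_neg_le; lra.
have rP k k' : l1 k <= l1 k' -> r1 k <= r1 k' -> l2 k <= l2 k' ->
    rspread P k <= rspread P k'.
  have [? ? ? ?] := pos k; have := q0 k' => *.
  by rewrite lerD2r; apply: max_mul_neg_le; lra.
by split=> //; split; (exact: lP || exact: rP).
Qed.
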